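(* Let $p\in(0,1]$ and $C\in\mathbb{R}$. If $C\ge 0$, then for the single-user Markov decision process with arrival probability $p$ and updating cost $C$ (described in the context), there exists a policy of the threshold type that is cost-optimal.
   Context: Single-user Markov decision process (MDP), in discrete time $t=0,1,2,\dots$. States: $\mathbf{s}(t)=(X(t),\Lambda(t))$ with age $X(t)\in\{1,2,\dots\}$ and arrival indicator $\Lambda(t)\in\{0,1\}$. Actions: $a(t)\in\{0,1\}$, where $1$ means ''update'' and $0$ means ''idle''; both actions are available in every state. Transitions: from state $(x,\lambda)$ under action $a$, the next age is $1$ if $a=\lambda=1$ and is $x+1$ otherwise; independently of the past, the next arrival indicator is $1$ with probability $p$ and $0$ with probability $1-p$. Immediate cost: $C\bigl((x,\lambda),a\bigr)=(x+1-x\,a\,\lambda)+C\,a$, where the real number $C$ is the updating cost. Policies: a policy $\mu=\{a(0),a(1),\dots\}$ specifies an action for each slot. It may be history dependent (the action $a(t)$ may depend on $\mathbf{s}(0),\dots,\mathbf{s}(t)$ and $a(0),\dots,a(t-1)$) and randomized (an action is chosen with a probability). A policy is stationary if $a(t_1)=a(t_2)$ whenever $\mathbf{s}(t_1)=\mathbf{s}(t_2)$, and deterministic if it chooses actions with certainty; thus a stationary deterministic policy is a function from states to actions. Average cost of a policy $\mu$: $\limsup_{T\to\infty}\frac{1}{T+1}E_\mu\left[\sum_{t=0}^{T}C(\mathbf{s}(t),a(t))\right]$, where $E_\mu$ is the expectation when $\mu$ is employed. A policy (possibly history dependent) is cost-optimal if it minimizes the average cost among all policies. Threshold type: a threshold-type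 policy is a stationary deterministic policy for which there exists a threshold $\bar X\in\{1,2,\dots\}$ such that the action in state $(x,\lambda)$ is to update if $\lambda=1$ and $x\ge\bar X$, and is to idle otherwise (in particular it idles in every state $(x,0)$). *)

(* Defs.v *)
From mathcomp Require Import all_boot all_order all_algebra.
From mathcomp Require Import all_classical all_reals all_analysis.

Set Implicit Arguments.
Unset Strict Implicit.
Unset Printing Implicit Defensive.

Import Order.TTheory GRing.Theory Num.Theory.
Local Open Scope classical_set_scope.
Local Open Scope ring_scope.

Notation age := {x : nat | (0 < x)%N}.

Notation state := (age * bool)%type.

(* [true] is "update" and [false] is "idle". *)
Notation action := bool (only parsing).

(* Histories are listed in reverse chronological order: the head is the most
   recent slot, so a history of size [t.+1] is
   [:: (s(t), a(t)); ...; (s(0), a(0))]. *)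
Notation history := (seq (state * action)).

Definition age1 : age := exist (fun x => is_true (0 < x)%N) 1%N isT.
Definition ageS (x : age) : age :=
  exist (fun x => is_true (0 < x)%N) (val x).+1 isT.

Definition next_age (s : state) (a : action) : age :=
  if a && s.2 then age1 else ageS s.1.

Section MDP.
Variables (R : realType) (p C : R).

Definition trans_prob (s : state) (a : action) (s' : state) : R :=
  (s'.1 == next_age s a)%:R * bernoulli_pmf p s'.2.

Definition cost (s : state) (a : action) : R :=
  let: x := (val s.1)%:R in
  (x + 1 - x * a%:R * s.2%:R) + C * a%:R.

(* History-dependent randomized policies: [upd_prob h s] is the probability of
   updating in the current state [s] given the previous states and actions [h];
   the current slot is [size h]. *)
Record policy : Type := Policy {
  upd_prob : history -> state -> R;
  upd_prob_itv : forall h s, 0 <= upd_prob h s <= 1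
}.

Definition act_prob (mu : policy) (h : history) (s : state) (a : action) : R :=
  bernoulli_pmf (upd_prob mu h s) a.

Definition state_prob (s0 : state) (h : history) (s : state) : R :=
  if h is (s', a') :: _ then trans_prob s' a' s else (s == s0)%:R.

(* Probability that the first [size h] slots of the process started in [s0] and
   controlled by [mu] follow [h]. *)
Fixpoint hist_prob (mu : policy) (s0 : state) (h : history) : R :=
  if h is (s, a) :: h' then
    hist_prob mu s0 h' * state_prob s0 h' s * act_prob mu h' s a
  else 1.

(* Expectation of a function of the first [n] slots. The sum ranges over all
   histories of size [n]; only finitely many of them have nonzero probability
   (see [finite_hist_prob] below). *)
Definition expect (mu : policy) (s0 : state) (n : nat) (F : history -> R) : R :=
  \sum_(h \in [set h : history | size h = n]) hist_prob mu s0 h * F h.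

Definition avg_cost (mu : policy) (s0 : state) : \bar R :=
  limn_esup (fun T : nat =>
    ((T.+1%:R)^-1 *
      expect mu s0 T.+1 (fun h => \sum_(sa <- h) cost sa.1 sa.2))%:E).

(* Optimality is required simultaneously for every initial state. *)
Definition cost_optimal (mu : policy) : Prop :=
  forall (s0 : state) (nu : policy), (avg_cost mu s0 <= avg_cost nu s0)%E.

Definition induced_by (mu : policy) (f : state -> action) : Prop :=
  forall h s, upd_prob mu h s = (f s)%:R.

Definition threshold_type (mu : policy) : Prop :=
  exists f : state -> action, induced_by mu f /\
    exists X : age, forall (x : age) (l : bool),
      f (x, l) = l && (val X <= val x)%N.

(* Sanity checks: the sum defining [expect] is a genuine finite sum, over a
   probability distribution. *)

Definition state_succ (s0 : state) (h : history) : seq state :=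
  if h is (s', a') :: _ then [:: (next_age s' a', true); (next_age s' a', false)]
  else [:: s0].

Fixpoint reach (s0 : state) (n : nat) : seq history :=
  if n is n'.+1 then
    [seq (sa.1, sa.2) :: h | h <- reach s0 n',
       sa <- [seq (s, a) | s <- state_succ s0 h, a <- [:: true; false]]]
  else [:: [::]].

Lemma reachS s0 n : reach s0 n.+1 =
  [seq (sa.1, sa.2) :: h | h <- reach s0 n,
     sa <- [seq (s, a) | s <- state_succ s0 h, a <- [:: true; false]]].
Proof. by []. Qed.

Lemma state_prob_supp s0 h s : s \notin state_succ s0 h -> state_prob s0 h s = 0.
Proof.
case: h => [|[s' a'] h] /=; first by rewrite inE => /negPf ->.
case: s => x l; rewrite /trans_prob !inE !xpair_eqE /=.
case: (x == _) => /=; first by case: l.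
by rewrite mul0r.
Qed.

Lemma reach_size s0 n h : h \in reach s0 n -> size h = n.
Proof.
elim: n h => [|n IH] h; first by rewrite inE => /eqP ->.
rewrite reachS; case/allpairsPdep => h' [sa [h'in _ ->]] /=; by rewrite (IH _ h'in).
Qed.

Lemma hist_prob_supp mu s0 h :
  h \notin reach s0 (size h) -> hist_prob mu s0 h = 0.
Proof.
elim: h => [|[s a] h IH] //; rewrite [size _]/= reachS [hist_prob _ _ _]/=.
have [hin nin|/IH -> _] := boolP (h \in reach s0 (size h)); last by rewrite !mul0r.
rewrite state_prob_supp ?mulr0 ?mul0r//; apply: contra nin => sin.
apply/allpairsPdep; exists h, (s, a); split => //.
by apply/allpairsPdep; exists s, a; split => //; case: a.
Qed.

Lemma finite_hist_prob mu s0 n :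
  finite_set [set h : history | size h = n /\ hist_prob mu s0 h <> 0].
Proof.
apply: (sub_finite_set _ (finite_seq (reach s0 n))) => h /= [<- /eqP].
by apply: contraNT => /hist_prob_supp -> //; exact/eqP.
Qed.

Lemma reach_uniq s0 n : uniq (reach s0 n).
Proof.
elim: n => [|n IH] //; rewrite reachS; apply: allpairs_uniq_dep => //.
- move=> h _; apply: allpairs_uniq => //; last by move=> [? ?] [? ?] _ _ [-> ->].
  by case: h => [|[s a] h] //=; rewrite !inE xpair_eqE andbF.
- by move=> [h [s a]] [h' [s' a']] _ _ /= [-> -> ->].
Qed.

Lemma expectE mu s0 n F :
  expect mu s0 n F = \sum_(h <- reach s0 n) hist_prob mu s0 h * F h.
Proof.
rewrite /expect (fsbigE (reach s0 n)) ?reach_uniq//.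
- rewrite big_seq_cond [RHS]big_seq; apply: eq_bigl => h.
  by apply: andb_idr => /reach_size hn; rewrite inE.
- by move=> h /= /reach_size.
- by move=> h /= <- /hist_prob_supp ->; rewrite mul0r.
Qed.

Lemma hist_prob_total mu s0 n : expect mu s0 n (fun=> 1) = 1.
Proof.
rewrite expectE; under eq_bigr do rewrite mulr1.
elim: n => [|n IH]; first by rewrite big_seq1.
rewrite reachS big_allpairs_dep -[RHS]IH; apply: eq_bigr => h _.
rewrite big_allpairs_dep /=.
have bern1 q : bernoulli_pmf q true + bernoulli_pmf q false = 1 :> R.
  by rewrite /bernoulli_pmf addrC subrK.
under eq_bigr do rewrite !big_cons big_nil addr0 -mulrDr bern1 mulr1.
rewrite -mulr_sumr -[RHS]mulr1; congr (_ * _).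
case: h => [|[s a] h] /=; first by rewrite big_seq1 eqxx.
by rewrite !big_cons big_nil addr0 /trans_prob /= eqxx !mul1r bern1.
Qed.

End MDP.

(* Main.v *)
(* The average-cost optimality equation is solved explicitly. Writing H for the
   relative cost as a function of the age, a = 1/p - 1 and n for the least
   positive integer with C <= n (n + 1) / 2 + a n, the threshold-n policy
   attains the minimum in the equation, with average cost
   g = (n (n + 1) / 2 + a n + a / p + C) / (n + a).

   Let S_T be the expected cost of the first T slots under an arbitrary policy,
   and N_T the age after them. The optimality equation gives
   S_T + E H(N_T) >= g T + c, with equality for the threshold policy; as H >= 0,
   the latter has average cost at most g. For p < 1 the function H is unbounded, so
   E H(N_T) / T need not vanish for other policies. However H(N_T) is at most
   a N_T + B and N_T is at most the cost of the last slot, so if S_T were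
   eventually below (g - e) T, then the increments of a S_T would grow linearly
   in T and a S_T quadratically, which is absurd. *)
Require Import Defs.
From mathcomp Require Import all_boot all_order all_algebra.
From mathcomp Require Import all_classical all_reals all_analysis.
From mathcomp Require Import ring lra.

Import Order.TTheory GRing.Theory Num.Theory.
Local Open Scope classical_set_scope.
Local Open Scope ring_scope.

Set Implicit Arguments.
Unset Strict Implicit.

(** * The threshold and the optimality equation *)

(* With a = 1/p - 1, the two inequalities say that the average cost g of the
   threshold-n policy satisfies n + a <= g <= n + 1 + a; C >= 0 is what makes
   n = 1 admissible. *)
Lemma exists_threshold (R : realType) (a C : R) : 0 <= a -> 0 <= C ->
  exists n : nat, [/\ (0 < n)%N, C <= n%:R * (n%:R + 1) / 2 + a * n%:R
    & n%:R * (n%:R - 1) / 2 + a * (n%:R - 1) <= C].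
Proof.
move=> a_ge0 C_ge0.
pose P m := C <= m.+1%:R * (m.+1%:R + 1) / 2 + a * m.+1%:R.
have exP : exists m, P m.
  exists (Num.truncn C); rewrite /P.
  have := truncnS_gt C; have : 1 <= (Num.truncn C).+1%:R :> R by rewrite ler1n.
  move: (Num.truncn C).+1%:R => x x_ge1 Cx; nra.
case: (ex_minnP exP) => -[|m] Pm minm; first by exists 1%N; split => //; lra.
exists m.+2; split => //; rewrite leNgt; apply/negP => ltC.
suff /minm : P m by rewrite ltnn.
rewrite /P; move: ltC; rewrite -(natr1 m.+1); lra.
Qed.

(* Throughout, [H x] is the relative cost of entering a slot with age [x] before
   the arrival indicator is revealed, normalized by [H 1 = 0]. *)
Definition idle_value {R : realType} (H : nat -> R) (x : nat) : R :=
  x%:R + 1 + H x.+1.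

(** On an arrival, updating costs 1 + C and leads to [H 1 = 0]; without one, idling is at least as
    good. The case split records which action is best on an arrival. *)
Lemma bellman_solution (R : realType) (p C : R) : 0 < p -> p <= 1 -> 0 <= C ->
  exists (g : R) (H : nat -> R) (n : nat) (a B : R),
  [/\ (0 < n)%N, 0 <= a, H 1 = 0,
      forall x, (0 < x)%N -> 0 <= H x <= a * x%:R + B &
      forall x, (0 < x)%N ->
        if (n <= x)%N
        then 1 + C <= idle_value H x /\
             g + H x = (1 - p) * idle_value H x + p * (1 + C)
        else idle_value H x <= 1 + C /\ g + H x = idle_value H x].
Proof.
move=> p_gt0 p_le1 C_ge0.
pose a := p^-1 - 1.
have pa1 : p * (1 + a) = 1 by rewrite /a addrC subrK divff// gt_eqF.
have a_ge0 : 0 <= a by rewrite subr_ge0 invf_ge1.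
have [n [n_gt0 Cle leC]] := exists_threshold a_ge0 C_ge0.
have n_ge1 : 1 <= n%:R :> R by rewrite ler1n.
pose N : R := n%:R; rewrite -/N in Cle leC n_ge1.
(* Mean cost over mean length of a cycle between updates: n - 1 idle slots, then a wait for an
   arrival, of mean 1/p = 1 + a slots including the update. *)
pose g := (N * (N + 1) / 2 + a * N + a * (1 + a) + C) / (N + a).
have Na_gt0 : 0 < N + a by lra.
have gE : g * (N + a) = N * (N + 1) / 2 + a * N + a * (1 + a) + C.
  by rewrite /g divfK// gt_eqF.
have g_ge : N + a <= g by rewrite /g ler_pdivlMr//; nra.
have g_le : g <= N + 1 + a by rewrite /g ler_pdivrMr//; nra.
(* The constant term that the equation for ages from n on forces on [H x = a x + b]. *)
pose b := (a - g) * (1 + a) + 1 + C.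
(* Above n, the fixed-point equation is solved by an affine function; below n,
   H x - H (x + 1) = x + 1 - g is summed down from n. *)
pose H (x : nat) := if (n <= x)%N then a * x%:R + b
  else a * N + b + (N * (N + 1) - x%:R * (x%:R + 1)) / 2 - (N - x%:R) * g.
have Hge x : (n <= x)%N -> H x = a * x%:R + b by rewrite /H => ->.
have Hle x : (x <= n)%N ->
    H x = a * N + b + (N * (N + 1) - x%:R * (x%:R + 1)) / 2 - (N - x%:R) * g.
  rewrite /H leq_eqVlt => /orP[/eqP ->|]; first by rewrite leqnn /N; lra.
  by rewrite ltnNge => /negbTE ->.
(* Once [b] is expanded, this normalization is [gE]. *)
have H1 : H 1%N = 0 by rewrite Hle// /b; lra.
have Hmono x : (x <= n)%N -> H x <= a * N + b.
  move=> xn; rewrite Hle//; move: xn; rewrite leq_eqVlt => /orP[/eqP ->|xn].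
    by rewrite /N; lra.
  have : x%:R + 1 <= N by rewrite natr1 ler_nat.
  have : 0 <= x%:R :> R by rewrite ler0n.
  move: x%:R => y y0 yN; nra.
have H0 x : (0 < x <= n)%N -> 0 <= H x.
  move=> /andP[x_gt0 xn]; rewrite -H1; have [x_le1|x_gt1] := leqP x 1.
    by rewrite (@anti_leq x 1%N) ?x_le1.
  rewrite !Hle//.
  have : 2 <= x%:R :> R by rewrite (ler_nat _ 2).
  have : x%:R <= N by rewrite ler_nat.
  rewrite mulr1n; move: x%:R => y y0 yN; nra.
exists g, H, n, a, `|a * N + b|; split => // x x_gt0.
  have [nx|/ltnW xn] := leqP n x.
    have := H0 n; rewrite n_gt0 leqnn !Hge// -/N => /(_ isT) anb.
    have : N <= x%:R by rewrite ler_nat.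
    have := ler_norm (a * N + b).
    move: x%:R => y; nra.
  rewrite H0 ?x_gt0//=; apply: (le_trans (Hmono _ xn)).
  by rewrite (le_trans (ler_norm _))// lerDr mulr_ge0.
rewrite /idle_value.
(* From n on, updating is no worse because [g <= N + 1 + a]; below n, idling is no worse because
   [N + a <= g]. *)
case: ifPn => [nx|]; last rewrite -ltnNge => xn.
  rewrite !Hge//; last exact: leqW.
  rewrite -(natr1 x); have : N <= x%:R by rewrite ler_nat.
  have pE : p * a = 1 - p by lra.
  move: x%:R => y Ny; split; first by rewrite /b; nra.
  rewrite /b; ring: pE.
split; last by rewrite !Hle//; [rewrite -(natr1 x); lra | exact: ltnW].
apply: (le_trans (lerD _ (Hmono _ xn))) (_ : N + (a * N + b) <= _).
  by rewrite natr1 ler_nat.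
by rewrite /b; nra.
Qed.

(** * Limits superior of running means *)

Lemma limn_esup_le_near (R : realType) (u : nat -> \bar R) (l : \bar R) :
  (\forall n \near \oo, (u n <= l)%E) -> (limn_esup u <= l)%E.
Proof.
move=> [N _ uN]; apply: (@le_trans _ _ (ereal_sup (u @` [set n | (N <= n)%N]))).
  by apply: ereal_inf_lbound; exists [set n | (N <= n)%N] => //; exists N.
by apply: ge_ereal_sup => _ [n /uN + <-].
Qed.

Lemma limn_esup_lt_near (R : realType) (u : nat -> \bar R) (l : \bar R) :
  (limn_esup u < l)%E -> \forall n \near \oo, (u n < l)%E.
Proof.
move=> /ereal_inf_lt[_ [V V_near <-] supV]; near=> n.
apply: le_lt_trans supV; apply: ereal_sup_ubound; exists n => //.
by near: n.
Unshelve. all: by end_near. Qed.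

Lemma limn_esup_mean_le (R : realType) (u : nat -> R) (g c : R) :
  (forall n, u n.+1 <= n.+1%:R * g + c) ->
  (limn_esup (fun n => (n.+1%:R^-1 * u n.+1)%:E) <= g%:E)%E.
Proof.
move=> ule; apply/lee_addgt0Pr => e e_gt0; apply: limn_esup_le_near.
exists (Num.truncn (`|c| / e)) => // n /= len.
rewrite -EFinD lee_fin ler_pdivrMl ?ltr0n//; apply: (le_trans (ule n)).
rewrite mulrDr lerD2l (le_trans (ler_norm c))// -ler_pdivrMr//.
by apply/ltW/(lt_le_trans (truncnS_gt _)); rewrite ler_nat ltnS.
Qed.

Lemma quadratic_not_linearly_bounded (R : realType) (e c d : R) :
  0 < e -> ~ (forall k : nat, e * k%:R ^+ 2 <= c * k%:R + d).
Proof.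
move=> e_gt0 bnd; pose M := (`|c| + `|d|) / e.
have := bnd (Num.truncn M).+1; have : M < (Num.truncn M).+1%:R := truncnS_gt _.
rewrite /M ltr_pdivrMr//; have : 1 <= (Num.truncn M).+1%:R :> R by rewrite ler1n.
have := ler_norm c; have := ler_norm d; have := normr_ge0 d.
move: (`|c|) (`|d|) (_.+1%:R) => c' d' x; nra.
Qed.

(* If S were eventually below (g - e) n, then b, hence the increments of a * S,
   would grow linearly, and a * S quadratically. *)
Lemma limn_esup_mean_ge (R : realType) (S b : nat -> R) (g c a B : R) :
  0 <= a -> (forall n, 0 <= S n) ->
  (forall n, n%:R * g + c <= S n + b n) ->
  (forall n, b n.+1 <= a * (S n.+1 - S n) + B) ->
  (g%:E <= limn_esup (fun n => (n.+1%:R^-1 * S n.+1)%:E))%E.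
Proof.
move=> a_ge0 S_ge0 Sb_ge b_le; apply/lee_subgt0Pr => e e_gt0.
rewrite leNgt; apply/negP; rewrite -EFinB => /limn_esup_lt_near[N _ SN].
have S_le k : S (N + k).+1 <= (g - e) * (N + k).+1%:R.
  have /= := SN (N + k)%N (leq_addr _ _).
  by rewrite lte_fin ltr_pdivrMl ?ltr0n// mulrC => /ltW.
have sum_le k : e / 2 * k%:R ^+ 2 + (c - B) * k%:R
    <= a * (S (N + k).+1 - S N.+1).
  elim: k => [|k IH]; first by rewrite addn0; lra.
  (* The increment of [a * S] is at least e (N + k + 2) + c - B, which exceeds the increment e (k +
     1/2) + c - B of the left-hand side. *)
  have := Sb_ge (N + k.+1).+1; have := b_le (N + k.+1)%N; have := S_le k.+1.
  have -> : (N + k.+1).+1%:R = N%:R + k%:R + 2 :> R.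
    by rewrite -natr1 natrD -natr1; lra.
  have eN_ge0 : 0 <= e * N%:R by rewrite mulr_ge0// ltW.
  have ek_ge0 : 0 <= e * k%:R by rewrite mulr_ge0// ltW.
  move: IH; rewrite addnS -(natr1 k); lra.
apply: (@quadratic_not_linearly_bounded _ (e / 2) (a * (g - e) + B - c)
  (a * (g - e) * N.+1%:R)); first by lra.
move=> k; have := sum_le k; have := S_le k; have := S_ge0 N.+1.
rewrite -addSn natrD => S0 Sk aSk.
have := ler_wpM2l a_ge0 S0; have := ler_wpM2l a_ge0 Sk; lra.
Qed.

(** * Conditional expectation over one slot *)

Definition step_mean {R : realType} (p : R) (mu : policy R) (s0 : state)
    (h : history) (F : state -> bool -> R) : R :=
  \sum_(s <- state_succ s0 h) state_prob p s0 h s *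
    (act_prob mu h s true * F s true + act_prob mu h s false * F s false).

(** Tower property: the last slot is averaged conditionally on the earlier ones. *)
Lemma expectS (R : realType) (p : R) mu s0 n (F : history -> R) :
  expect p mu s0 n.+1 F =
  expect p mu s0 n (fun h => step_mean p mu s0 h (fun s a => F ((s, a) :: h))).
Proof.
rewrite !expectE reachS big_allpairs_dep; apply: eq_bigr => h _.
rewrite big_allpairs_dep /= mulr_sumr; apply: eq_bigr => s _.
by rewrite !big_cons big_nil addr0 /=; ring.
Qed.

Lemma expect0 (R : realType) (p : R) mu s0 (F : history -> R) :
  expect p mu s0 0 F = F [::].
Proof. by rewrite expectE big_seq1 /= mul1r. Qed.

Lemma expectD (R : realType) (p : R) mu s0 n (F G : history -> R) :
  expect p mu s0 n (fun h => F h + G h) =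
  expect p mu s0 n F + expect p mu s0 n G.
Proof.
by rewrite !expectE -big_split; apply: eq_bigr => h _; rewrite mulrDr.
Qed.

Lemma expectZ (R : realType) (p : R) mu s0 n c (F : history -> R) :
  expect p mu s0 n (fun h => c * F h) = c * expect p mu s0 n F.
Proof.
by rewrite !expectE mulr_sumr; apply: eq_bigr => h _; rewrite mulrCA.
Qed.

Lemma expect_cst (R : realType) (p : R) mu s0 n c :
  expect p mu s0 n (fun=> c) = c.
Proof.
rewrite -[RHS]mulr1 -(hist_prob_total p mu s0 n) -expectZ.
by congr expect; apply/funext => h; rewrite mulr1.
Qed.

Lemma act_prob_ge0 (R : realType) (mu : policy R) h s a :
  0 <= act_prob mu h s a.
Proof. exact: bernoulli_pmf_ge0 (upd_prob_itv mu h s). Qed.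

Lemma act_prob_total (R : realType) (mu : policy R) h s :
  act_prob mu h s true + act_prob mu h s false = 1.
Proof. by rewrite /act_prob /bernoulli_pmf addrC subrK. Qed.

Lemma state_prob_ge0 (R : realType) (p : R) s0 h s : 0 <= p <= 1 ->
  0 <= state_prob p s0 h s.
Proof.
move=> p01; case: h => [|[s' a'] h] //=.
by rewrite mulr_ge0// bernoulli_pmf_ge0.
Qed.

Lemma hist_prob_ge0 (R : realType) (p : R) mu s0 h : 0 <= p <= 1 ->
  0 <= hist_prob p mu s0 h.
Proof.
move=> p01; elim: h => //= -[s a] h IH.
by rewrite !mulr_ge0 ?state_prob_ge0 ?act_prob_ge0.
Qed.

Lemma expect_le (R : realType) (p : R) mu s0 n (F G : history -> R) :
  0 <= p <= 1 -> (forall h, size h = n -> F h <= G h) ->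
  expect p mu s0 n F <= expect p mu s0 n G.
Proof.
move=> p01 FG; rewrite !expectE big_seq [leRHS]big_seq.
apply: ler_sum => h /reach_size hn.
by rewrite ler_wpM2l ?FG ?hist_prob_ge0.
Qed.

Lemma step_mean_le (R : realType) (p : R) mu s0 h (F G : state -> bool -> R) :
  0 <= p <= 1 -> (forall s a, F s a <= G s a) ->
  step_mean p mu s0 h F <= step_mean p mu s0 h G.
Proof.
move=> p01 FG; apply: ler_sum => s _.
by rewrite ler_wpM2l ?state_prob_ge0 ?lerD ?ler_wpM2l ?act_prob_ge0.
Qed.

Lemma step_meanD (R : realType) (p : R) mu s0 h (F G : state -> bool -> R) :
  step_mean p mu s0 h (fun s a => F s a + G s a) =
  step_mean p mu s0 h F + step_mean p mu s0 h G.
Proof. by rewrite -big_split; apply: eq_bigr => s _ /=; ring. Qed.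

Lemma step_mean_state (R : realType) (p : R) mu s0 h (w : state -> R) :
  step_mean p mu s0 h (fun s _ => w s) =
  \sum_(s <- state_succ s0 h) state_prob p s0 h s * w s.
Proof.
by apply: eq_bigr => s _; rewrite -mulrDl act_prob_total mul1r.
Qed.

Lemma sum_state_prob (R : realType) (p : R) s0 h (w : state -> R) :
  \sum_(s <- state_succ s0 h) state_prob p s0 h s * w s =
  if h is (s, a) :: _
  then p * w (next_age s a, true) + (1 - p) * w (next_age s a, false)
  else w s0.
Proof.
case: h => [|[s a] h] /=; first by rewrite big_seq1 eqxx mul1r.
by rewrite !big_cons big_nil addr0 /trans_prob /= eqxx !mul1r.
Qed.

Lemma step_mean_cst (R : realType) (p : R) mu s0 h c :
  step_mean p mu s0 h (fun _ _ => c) = c.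
Proof. by rewrite step_mean_state sum_state_prob; case: h => [|[s a] h]//; ring. Qed.

Lemma step_mean_induced (R : realType) (p : R) mu f s0 h F :
  induced_by mu f ->
  step_mean p mu s0 h F = step_mean p mu s0 h (fun s _ => F s (f s)).
Proof.
move=> muf; apply: eq_bigr => s _; rewrite /act_prob muf /bernoulli_pmf.
by case: (f s) => /=; ring.
Qed.

(** * Verification by telescoping *)

Definition total_cost {R : realType} (C : R) (h : history) : R :=
  \sum_(sa <- h) cost C sa.1 sa.2.

Lemma cost_ge_next_age (R : realType) (C : R) s a : 0 <= C ->
  (val (next_age s a))%:R <= cost C s a.
Proof.
move=> C_ge0; case: s => -[x x_gt0] l; rewrite /next_age /cost /=.
by case: a; case: l; rewrite /= -?natr1; lra.
Qed.

Definition act_value {R : realType} (C : R) (H : nat -> R) (s : state)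
    (a : bool) : R :=
  cost C s a + H (val (next_age s a)).

(* The value [w s0 - g] at the empty history makes the telescoping argument start
   from a known initial state. *)
Definition potential {R : realType} (g : R) (H : nat -> R) (w : state -> R)
    (s0 : state) (h : history) : R :=
  if h is (s, a) :: _ then H (val (next_age s a)) else w s0 - g.

Lemma step_mean_potential (R : realType) (p C g : R) (H : nat -> R)
    (w : state -> R) mu s0 h :
  step_mean p mu s0 h (fun s a => total_cost C ((s, a) :: h) +
    potential g H w s0 ((s, a) :: h)) =
  total_cost C h + step_mean p mu s0 h (act_value C H).
Proof.
rewrite -[X in X + _](step_mean_cst p mu s0 h) -step_meanD.
congr step_mean; apply/funext => s; apply/funext => a.
by rewrite /total_cost big_cons /potential /act_value; ring.
Qed.

Lemma step_mean_min_value (R : realType) (p g : R) (H : nat -> R)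
    (w : state -> R) mu s0 h :
  (forall x : age,
     p * w (x, true) + (1 - p) * w (x, false) = g + H (val x)) ->
  step_mean p mu s0 h (fun s _ => w s) = g + potential g H w s0 h.
Proof.
move=> wE; rewrite step_mean_state sum_state_prob.
by case: h => [|[s a] h] /=; [rewrite addrC subrK | rewrite wE].
Qed.

(** The mean of [w] in the next slot is [g] plus the current potential, and no action value is below
    [w]; so cost plus potential gains at least [g] per slot in the mean. *)
Lemma verification_ge (R : realType) (p C g : R) (H : nat -> R)
    (w : state -> R) mu s0 n :
  0 <= p <= 1 ->
  (forall x : age,
     p * w (x, true) + (1 - p) * w (x, false) = g + H (val x)) ->
  (forall s a, w s <= act_value C H s a) ->
  n%:R * g + (w s0 - g) <=
    expect p mu s0 n (total_cost C) + expect p mu s0 n (potential g H w s0).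
Proof.
move=> p01 wE w_le; rewrite -expectD.
elim: n => [|n IH].
  by rewrite expect0 /total_cost big_nil /=; lra.
rewrite expectS -natr1 mulrDl mul1r addrAC.
rewrite -[X in _ + X](expect_cst p mu s0 n).
apply: (le_trans (lerD IH (lexx _))); rewrite -expectD.
apply: expect_le => // h _; rewrite step_mean_potential -addrA lerD2l addrC.
by rewrite -(step_mean_min_value mu _ _ wE) step_mean_le.
Qed.

Lemma verification_eq (R : realType) (p C g : R) (H : nat -> R)
    (w : state -> R) mu f s0 n :
  (forall x : age,
     p * w (x, true) + (1 - p) * w (x, false) = g + H (val x)) ->
  induced_by mu f -> (forall s, w s = act_value C H s (f s)) ->
  expect p mu s0 n (total_cost C) + expect p mu s0 n (potential g H w s0) =
  n%:R * g + (w s0 - g).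
Proof.
move=> wE muf w_eq; rewrite -expectD.
elim: n => [|n IH].
  by rewrite expect0 /total_cost big_nil /=; lra.
rewrite expectS -natr1 mulrDl mul1r addrAC -IH.
rewrite -[X in _ = _ + X](expect_cst p mu s0 n) -expectD.
congr expect; apply/funext => h.
rewrite step_mean_potential (step_mean_induced _ _ _ _ muf).
under (_ : (fun s (_ : bool) => act_value C H s (f s)) = fun s _ => w s).
  by apply/funext => s; apply/funext => _; rewrite w_eq.
by rewrite (step_mean_min_value _ _ _ wE); ring.
Qed.

(** * Optimality of the threshold policy *)

Definition threshold_rule (n : nat) (s : state) : bool :=
  s.2 && (n <= val s.1)%N.

Lemma deterministic_policy (R : realType) (f : state -> bool) :
  exists mu : policy R, induced_by mu f.
Proof.
have f01 (h : history) s : 0 <= ((f s)%:R : R) <= 1.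
  by case: (f s); rewrite lexx ler01.
by exists (Policy f01).
Qed.

Unset Implicit Arguments.

Theorem theorem4 (R : realType) (p C : R) (p_gt0 : 0 < p) (p_le1 : p <= 1)
    (C_ge0 : 0 <= C) :
  exists mu : policy R, threshold_type mu /\ cost_optimal p C mu.
Proof.
have p01 : 0 <= p <= 1 by rewrite ltW.
have [g [H [n [a [B [n_gt0 a_ge0 H1 H_itv HB]]]]]] :=
  bellman_solution p_gt0 p_le1 C_ge0.
pose f := threshold_rule n.
pose w s := act_value C H s (f s).
have [mu muf] := deterministic_policy R f.
exists mu; split.
  by exists f; split => //; exists (exist _ n n_gt0).
have wE (x : age) :
    p * w (x, true) + (1 - p) * w (x, false) = g + H (val x).
  have := HB _ (valP x); rewrite /w /act_value /f /threshold_rule /cost /=.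
  rewrite /next_age /idle_value /=.
  by case: ifP => _ -[_ ->]; rewrite /= ?H1; ring.
(* With an arrival this is the comparison in [HB]; without one, updating only adds C >= 0. *)
have w_le s b : w s <= act_value C H s b.
  case: s => x l; have := HB _ (valP x).
  rewrite /w /act_value /f /threshold_rule /cost /next_age /idle_value /=.
  by case: ifP => _ -[le_HC _]; case: l; case: b; rewrite /= ?H1; lra.
move=> s0 nu; apply: (@le_trans _ _ g%:E).
  apply: (@limn_esup_mean_le _ (fun k => expect p mu s0 k (total_cost C))
    g (w s0 - g)) => k.
  (* It remains to see that the mean potential is nonnegative. Having k + 1 slots excludes the empty
     history, whose potential [w s0 - g] can be negative. *)
  rewrite -(verification_eq _ _ wE muf (fun=> erefl)) lerDl.
  rewrite -[leLHS](expect_cst p mu s0 k.+1); apply: expect_le => // -[|[s b] h]//= _.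
  by have /andP[] := H_itv _ (valP (next_age s b)).
apply: (@limn_esup_mean_ge _ (fun k => expect p nu s0 k (total_cost C))
  (fun k => expect p nu s0 k (potential g H w s0)) g (w s0 - g) a B) => //.
- move=> k; rewrite -[leLHS](expect_cst p nu s0 k); apply: expect_le => // h _.
  rewrite /total_cost sumr_ge0// => -[s b] _.
  by apply: le_trans (cost_ge_next_age s b C_ge0).
- by move=> k; exact: verification_ge.
(* H grows at most linearly, and the cost of a slot dominates the next age. *)
move=> k; suff : expect p nu s0 k.+1 (potential g H w s0) +
    a * expect p nu s0 k (total_cost C) <=
  a * expect p nu s0 k.+1 (total_cost C) + B by lra.
rewrite -!expectZ -[X in _ <= _ + X](expect_cst p nu s0 k).
rewrite !(expectS _ nu) -!expectD; apply: expect_le => // h _.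
rewrite -[X in _ + X <= _](step_mean_cst p nu s0 h).
rewrite -[X in _ <= _ + X](step_mean_cst p nu s0 h) -!step_meanD.
apply: step_mean_le => // s b.
rewrite /total_cost big_cons /=.
have /andP[_ H_le] := H_itv _ (valP (next_age s b)).
have := ler_wpM2l a_ge0 (cost_ge_next_age s b C_ge0); lra.
Qed.
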